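(* Let $\mathfrak{g}$ be a real nilpotent Lie algebra of dimension $2m+1$ ($m\ge 1$) equipped with a non-degenerate CR structure $(\mathcal{D},J)$. Then $\mathfrak{g}$ with this CR structure is pseudo-Sasakian, and $\mathfrak{g}$ is a central extension $0\to\mathbb{R}\to\mathfrak{g}\to\mathfrak{n}\to 0$ by $\mathbb{R}$ of a pseudo-Kählerian nilpotent Lie algebra $\mathfrak{n}$. In particular, if the CR structure is strictly pseudoconvex, then $\mathfrak{g}$ is Sasakian, and $\mathfrak{g}$ is isomorphic to the Heisenberg Lie algebra $\mathfrak{h}_{2m+1}$ (which is a central extension by $\mathbb{R}$ of an abelian Lie algebra).
   Context: All Lie algebras are finite-dimensional and real unless complexified. CR structure (of codimension one) on a Lie algebra $\mathfrak{g}$ of dimension $2m+1$: a complex subalgebra $\mathfrak{k}\subset\mathfrak{g}_{\mathbb{C}}=\mathfrak{g}\otimes\mathbb{C}$ of complex dimension $m$ with $\mathfrak{k}\cap\overline{\mathfrak{k}}=\{0\}$. Equivalently, a pair $(\mathcal{D},J)$ with $\mathcal{D}\subset\mathfrak{g}$ a subspace of codimension $1$ and $J:\mathcal{D}\to\mathcal{D}$ linear with $J^2=-1$ such that for all $X,Y\in\mathcal{D}$ one has $[JX,Y]+[X,JY]\in\mathcal{D}$ and $[JX,JY]-[X,Y]-J([X,JY]+[JX,Y])=0$; the correspondence is $\mathfrak{k}=\{X-\sqrt{-1}\,JX : X\in\mathcal{D}\}$, $\mathcal{D}_{\mathbb{C}}=\mathfrak{k}\oplus\overline{\mathfrak{k}}$.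 Levi form: the Hermitian form on $\mathfrak{k}$ with values in the line $\mathfrak{g}_{\mathbb{C}}/(\mathfrak{k}\oplus\overline{\mathfrak{k}})$ given by $h(X,Y)=-\sqrt{-1}\,[X,\overline{Y}] \bmod (\mathfrak{k}\oplus\overline{\mathfrak{k}})$. The CR structure is non-degenerate if $h$ is non-degenerate, and strictly pseudoconvex if $h$ is positive definite or negative definite. For a non-degenerate CR structure, a form $\phi\in\mathfrak{g}^*$ with $\ker\phi=\mathcal{D}$ is a contact form ($\phi\wedge(d\phi)^m\neq 0$), with Reeb field $\eta\in\mathfrak{g}$ determined by $\phi(\eta)=1$, $i(\eta)d\phi=0$. Let $\widetilde{J}$ be the endomorphism of $\mathfrak{g}$ with $\widetilde{J}|_{\mathcal{D}}=J$, $\widetilde{J}\eta=0$, and let $\langle X,Y\rangle=\phi(X)\phi(Y)+d\phi(\widetilde{J}X,Y)$, a non-degenerate symmetric bilinear form. The Lie algebra with this CR structure is called pseudo-Sasakian if $\langle[\eta,X],Y\rangle+\langle X,[\eta,Y]\rangle=0$ for all $X,Y\in\mathfrak{g}$; this is equivalent to the normality condition $[\eta,\mathfrak{k}]\subset\mathfrak{k}$. It is called Sasakian if moreover $\phi$ can be chosen so that $\langle\cdot,\cdot\rangle$ is positive definite. A pseudo-Kählerian Lie algebra is a Lie algebra $\mathfrak{n}$ of even dimension with a complex structure $J$ ($J^2=-1$) with vanishing Nijenhuis tensor and a non-degenerate symmetric bilinear form $\langle\cdot,\cdot\rangle$ (of arbitrary signature), with respect to which $J$ is skew-symmetric, such that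 $\omega=\langle J\cdot,\cdot\rangle$ is closed as a form on $\mathfrak{n}$. The Heisenberg Lie algebra $\mathfrak{h}_{2m+1}$ has basis $X_1,\dots,X_m,Y_1,\dots,Y_m,Z$ with only non-zero brackets $[X_i,Y_i]=-Z$. *)

(* Defs.v *)
From HB Require Import structures.
From mathcomp Require Import all_boot all_order all_algebra.
From mathcomp Require Import sesquilinear complex classical_sets reals ring lra.

Set Implicit Arguments.
Unset Strict Implicit.
Unset Printing Implicit Defensive.

Import Order.TTheory GRing.Theory Num.Theory.
Import VectorInternalTheory.
Local Open Scope ring_scope.

(* Lie algebras over a field, finite-dimensional because of the underlying
   [vectType]. *)
HB.mixin Record Vector_isLie (F : fieldType) (L : Type) of Vector F L := {
  lie_bracket : L -> L -> L;
  lie_bracketPl : forall (a : F) (x y z : L),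
    lie_bracket (a *: x + y) z = a *: lie_bracket x z + lie_bracket y z;
  lie_bracketPr : forall (a : F) (x y z : L),
    lie_bracket z (a *: x + y) = a *: lie_bracket z x + lie_bracket z y;
  lie_bracketxx : forall x : L, lie_bracket x x = 0;
  lie_jacobi : forall x y z : L,
    lie_bracket x (lie_bracket y z) + lie_bracket y (lie_bracket z x)
      + lie_bracket z (lie_bracket x y) = 0
}.

#[short(type="lieAlgType")]
HB.structure Definition LieAlgebra (F : fieldType) :=
  { L of Vector_isLie F L & Vector F L }.

Notation "[ 'lie' x , y ]" := (lie_bracket x y)
  (at level 0, x at level 99, y at level 99, format "[ 'lie'  x ,  y ]")
  : ring_scope.

Section LieNotions.
Variable F : fieldType.
Implicit Types L n : lieAlgType F.

Definition lie_prodv L (U V : {vspace L}) : {vspace L} :=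
  <<[seq [lie u, v] | u <- vbasis U, v <- vbasis V]>>%VS.

Fixpoint lower_central L (k : nat) : {vspace L} :=
  if k is k'.+1 then lie_prodv fullv (lower_central L k') else fullv.

Definition lie_nilpotent L : Prop := exists k, lower_central L k = 0%VS.

Definition lie_abelian L : Prop := forall x y : L, [lie x, y] = 0.

Definition lie_hom L n (f : 'Hom(L, n)) : Prop :=
  forall x y, f [lie x, y] = [lie f x, f y].

Definition lie_isomorphic L n : Prop :=
  exists f : 'Hom(L, n), [/\ lie_hom f, lker f = 0%VS & limg f = fullv].

(* 0 -> F -> L -> n -> 0 exact with central image of F; centrality makes [i] a
   homomorphism from the abelian Lie algebra F. *)
Definition central_extension L n : Prop :=
  exists (i : 'Hom(F^o, L)) (p : 'Hom(L, n)),
    [/\ lie_hom p, lker i = 0%VS, limg i = lker p, limg p = fullv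
      & forall (a : F^o) (x : L), [lie i a, x] = 0].

Section BracketTheory.
Variable L : lieAlgType F.
Implicit Types (a : F) (x y z : L).

Fact lie_bracketDl x y z : [lie x + y, z] = [lie x, z] + [lie y, z].
Proof. by rewrite -{1}[x]scale1r lie_bracketPl scale1r. Qed.
Fact lie_bracketDr x y z : [lie z, x + y] = [lie z, x] + [lie z, y].
Proof. by rewrite -{1}[x]scale1r lie_bracketPr scale1r. Qed.
Fact lie_bracket0l z : [lie 0 : L, z] = 0.
Proof. by apply: (addrI [lie 0, z]); rewrite -lie_bracketDl !addr0. Qed.
Fact lie_bracket0r z : [lie z, 0 : L] = 0.
Proof. by apply: (addrI [lie z, 0]); rewrite -lie_bracketDr !addr0. Qed.
Fact lie_bracketZl a x z : [lie a *: x, z] = a *: [lie x, z].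
Proof. by rewrite -[a *: x]addr0 lie_bracketPl lie_bracket0l addr0. Qed.
Fact lie_bracketZr a x z : [lie z, a *: x] = a *: [lie z, x].
Proof. by rewrite -[a *: x]addr0 lie_bracketPr lie_bracket0r addr0. Qed.
Fact lie_bracketNl x z : [lie - x, z] = - [lie x, z].
Proof. by rewrite -scaleN1r lie_bracketZl scaleN1r. Qed.
Fact lie_bracketNr x z : [lie z, - x] = - [lie z, x].
Proof. by rewrite -scaleN1r lie_bracketZr scaleN1r. Qed.
Fact lie_anticomm x y : [lie x, y] = - [lie y, x].
Proof.
apply/eqP; rewrite -addr_eq0; apply/eqP; have := lie_bracketxx (x + y).
by rewrite lie_bracketDl !lie_bracketDr !lie_bracketxx add0r addr0.
Qed.

Definition lie_bracketE :=
  (lie_bracketDl, lie_bracketDr, lie_bracketZl, lie_bracketZr,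
   lie_bracketNl, lie_bracketNr).
End BracketTheory.
End LieNotions.

Section Coordinates.
Variables (F : fieldType) (V : vectType F).
Local Notation coordinate u j := (v2r (u : V) 0 j).

Fact coordinateD u v j : coordinate (u + v) j = coordinate u j + coordinate v j.
Proof. by rewrite linearD mxE. Qed.
Fact coordinateN u j : coordinate (- u) j = - coordinate u j.
Proof. by rewrite linearN mxE. Qed.
Fact coordinateZ a u j : coordinate (a *: u) j = a * coordinate u j.
Proof. by rewrite linearZ mxE. Qed.
Fact coordinate0 j : coordinate 0 j = 0.
Proof. by rewrite linear0 mxE. Qed.
Definition coordinateE := (coordinateD, coordinateN, coordinateZ, coordinate0).

Fact coordinate_inj (u v : V) :
  (forall j, coordinate u j = coordinate v j) -> u = v.
Proof. by move=> uv; apply/v2r_inj/rowP. Qed.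
End Coordinates.

(* The complexification g (x) C: the pair (x, y) stands for x + i y. *)
Definition complexification (R : realType) (V : Type) : Type := (V * V)%type.

Section ComplexificationVector.
Variables (R : realType) (V : vectType R).
Local Notation VC := (complexification R V).

HB.instance Definition _ := GRing.Zmodule.on VC.

Definition cplx_scale (c : R[i]) (z : VC) : VC :=
  (complex.Re c *: z.1 - complex.Im c *: z.2,
   complex.Re c *: z.2 + complex.Im c *: z.1).

Fact cplx_scaleA a b v :
  cplx_scale a (cplx_scale b v) = cplx_scale (a * b) v.
Proof.
case: a b v => [a1 a2] [b1 b2] [x y]; congr pair;
  apply: coordinate_inj => j;
  by rewrite /= !coordinateE; ring.
Qed.

Fact cplx_scale1 : left_id 1 cplx_scale.
Proof. by case=> x y; congr pair; rewrite /= scale1r scale0r ?subr0 ?addr0. Qed.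

Fact cplx_scaleDr : right_distributive cplx_scale +%R.
Proof.
by case=> [a b] [x y] [u v]; congr pair; rewrite /= !scalerDr ?opprD addrACA.
Qed.

Fact cplx_scaleDl v : {morph cplx_scale^~ v : a b / a + b}.
Proof.
by case: v => x y [a b] [c d]; congr pair;
   rewrite /= !scalerDl ?opprD addrACA.
Qed.

HB.instance Definition _ := GRing.Zmodule_isLmodule.Build R[i] VC
  cplx_scaleA cplx_scale1 cplx_scaleDr cplx_scaleDl.

Fact cplx_vect_axiom : Vector.axiom (dim V) VC.
Proof.
pose f (z : VC) : 'rV[R[i]]_(dim V) := \row_j
  Complex (v2r z.1 0 j) (v2r z.2 0 j).
pose g (r : 'rV[R[i]]_(dim V)) : VC :=
  (r2v (\row_j complex.Re (r 0 j)),
   r2v (\row_j complex.Im (r 0 j))).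
exists f.
  move=> [a b] [x y] [u v]; apply/rowP => j; rewrite !mxE /=.
  by rewrite !coordinateE.
exists g; [case=> x y|move=> r].
  by congr pair; apply: v2r_inj;
     rewrite r2vK; apply/rowP => j; rewrite !mxE.
apply/rowP => j; rewrite !mxE /= !r2vK !mxE.
by case: (r 0 j).
Qed.

HB.instance Definition _ := Lmodule_hasFinDim.Build R[i] VC cplx_vect_axiom.
End ComplexificationVector.

Section ComplexificationLie.
Variables (R : realType) (g : lieAlgType R).
Local Notation gC := (complexification R g).

Definition cplx_bracket (z w : gC) : gC :=
  ([lie z.1, w.1] - [lie z.2, w.2], [lie z.1, w.2] + [lie z.2, w.1]).

Fact cplx_bracketxx z : cplx_bracket z z = 0.
Proof.
case: z => x y; congr pair => /=; first by rewrite !lie_bracketxx subr0.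
by rewrite (lie_anticomm y x) subrr.
Qed.

Fact cplx_bracketPl (c : R[i]) (x y z : gC) :
  cplx_bracket (c *: x + y) z = c *: cplx_bracket x z + cplx_bracket y z.
Proof.
case: c x y z => [a b] [x x'] [y y'] [z z']; congr pair;
  rewrite /= !lie_bracketE; apply: coordinate_inj => j;
  by rewrite !coordinateE; ring.
Qed.

Fact cplx_bracketPr (c : R[i]) (x y z : gC) :
  cplx_bracket z (c *: x + y) = c *: cplx_bracket z x + cplx_bracket z y.
Proof.
case: c x y z => [a b] [x x'] [y y'] [z z']; congr pair;
  rewrite /= !lie_bracketE; apply: coordinate_inj => j;
  by rewrite !coordinateE; ring.
Qed.

Fact cplx_jacobi x y z :
  cplx_bracket x (cplx_bracket y z) + cplx_bracket y (cplx_bracket z x)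
    + cplx_bracket z (cplx_bracket x y) = 0.
Proof.
have J (u v w : g) j : v2r
    ([lie u, [lie v, w]] + [lie v, [lie w, u]] + [lie w, [lie u, v]]) 0 j = 0.
  by rewrite lie_jacobi linear0 mxE.
case: x y z => [x x'] [y y'] [z z']; congr pair; rewrite /= !lie_bracketE;
  apply: coordinate_inj => j.
- move: (J x y z j) (J x y' z' j) (J x' y z' j) (J x' y' z j).
  by rewrite !coordinateE; lra.
- move: (J x' y' z' j) (J x' y z j) (J x y' z j) (J x y z' j).
  by rewrite !coordinateE; lra.
Qed.

HB.instance Definition _ := Vector_isLie.Build R[i] gC
  cplx_bracketPl cplx_bracketPr cplx_bracketxx cplx_jacobi.

Definition cplx_conj (z : gC) : gC := (z.1, - z.2).

(* The complex-linear extension of a real linear form. *)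
Definition cplx_form (phi : 'Hom(g, R^o)) (z : gC) : R[i] :=
  Complex (phi z.1) (phi z.2).
End ComplexificationLie.

Section CR.
Variables (R : realType) (g : lieAlgType R).
Local Notation gC := (complexification R g).

Local Open Scope classical_set_scope.

(* The argument of J in the last axiom lies in D by the previous one, and
   [vsproj D] is the identity on D. *)
Record cr_structure := CRStructure {
  cr_D : {vspace g};
  cr_J : 'End(subvs_of cr_D);
  cr_codim1 : \dim {:g} = (\dim cr_D).+1;
  cr_J2 : forall X, cr_J (cr_J X) = - X;
  cr_Levi : forall X Y : subvs_of cr_D,
    [lie vsval (cr_J X), vsval Y] + [lie vsval X, vsval (cr_J Y)] \in cr_D;
  cr_integrable : forall X Y : subvs_of cr_D,
    [lie vsval (cr_J X), vsval (cr_J Y)] - [lie vsval X, vsval Y]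
      - vsval (cr_J (vsproj cr_D
          ([lie vsval X, vsval (cr_J Y)] + [lie vsval (cr_J X), vsval Y]))) = 0
}.

Variable cr : cr_structure.
Local Notation D := (cr_D cr).
Local Notation J := (cr_J cr).
Implicit Types (phi : 'Hom(g, R^o)) (eta X Y : g).

(* k = {X - i JX : X in D} *)
Definition cr_k : set gC :=
  range (fun X : subvs_of D => (vsval X, - vsval (J X)) : gC).

Definition cr_DC : set gC := [set z + w | z in cr_k & w in @cplx_conj R g @` cr_k].

(* A representative in g_C of the Levi form h(z, w) in g_C / cr_DC. *)
Definition levi (z w : gC) : gC := - ('i%C *: [lie z, cplx_conj w]).

Definition cr_nondegenerate : Prop :=
  forall z, cr_k z -> (forall w, cr_k w -> cr_DC (levi z w)) -> z = 0.

(* A form phi with kernel D induces an isomorphism of the line g_C / cr_DC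
   with C compatible with the real structures; on R[i], [0 < c] means that c is
   real and positive. Changing the sign of phi exchanges the two cases. *)
Definition strictly_pseudoconvex : Prop :=
  exists2 phi, lker phi = D &
    (forall z, cr_k z -> z != 0 -> 0 < cplx_form phi (levi z z)) \/
    (forall z, cr_k z -> z != 0 -> cplx_form phi (levi z z) < 0).

(* d phi, with the convention d phi (X, Y) = - phi [X, Y]. *)
Definition lie_d phi X Y : R := - phi [lie X, Y].

Definition is_reeb phi eta : Prop :=
  phi eta = 1 /\ forall X, lie_d phi eta X = 0.

(* The endomorphism extending J by 0 on eta, when ker phi = D, phi eta = 1. *)
Definition cr_Jtilde phi eta X : g :=
  vsval (J (vsproj D (X - phi X *: eta))).

Definition cr_metric phi eta X Y : R :=
  phi X * phi Y + lie_d phi (cr_Jtilde phi eta X) Y.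

(* Forms phi with kernel D exist, D being a hyperplane; they are unique up to
   a nonzero scalar, on which the condition does not depend. *)
Definition pseudo_sasakian : Prop :=
  forall phi, lker phi = D ->
    exists eta, unique (is_reeb phi) eta /\
      forall X Y, cr_metric phi eta [lie eta, X] Y
                    + cr_metric phi eta X [lie eta, Y] = 0.

Definition sasakian : Prop :=
  pseudo_sasakian /\
  exists phi eta, [/\ lker phi = D, is_reeb phi eta
    & forall X, X != 0 -> 0 < cr_metric phi eta X X].
End CR.

Section PseudoKahler.
Variables (R : realType) (n : lieAlgType R).

Definition nijenhuis (J : 'End(n)) (X Y : n) : n :=
  [lie J X, J Y] - J [lie J X, Y] - J [lie X, J Y] - [lie X, Y].

Definition closed2 (omega : n -> n -> R) : Prop :=
  forall X Y Z,
    omega [lie X, Y] Z + omega [lie Y, Z] X + omega [lie Z, X] Y = 0.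

Definition pseudo_kahler : Prop :=
  ~~ odd (\dim {:n}) /\
  exists (J : 'End(n)) (B : {symmetric n}),
    [/\ forall X, J (J X) = - X,
        forall X Y, nijenhuis J X Y = 0,
        nondegenerate B,
        forall X Y, B (J X) Y = - B X (J Y)
      & closed2 (fun X Y => B (J X) Y)].
End PseudoKahler.

(* h_{2m+1}: the triple (x, y, z) stands for
   \sum_i x_i X_i + \sum_i y_i Y_i + z Z, where [X_i, Y_i] = - Z. *)
Definition heisenberg (R : realType) (m : nat) : Type :=
  ('rV[R]_m * 'rV[R]_m * R^o)%type.

Section Heisenberg.
Variables (R : realType) (m : nat).
Local Notation h := (heisenberg R m).

HB.instance Definition _ := Vector.on h.

Definition heisenberg_bracket (u v : h) : h :=
  (0, 0, \sum_(i < m) (u.1.2 0 i * v.1.1 0 i - u.1.1 0 i * v.1.2 0 i)).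

Fact heisenberg_bracketPl (a : R) (x y z : h) :
  heisenberg_bracket (a *: x + y) z
    = a *: heisenberg_bracket x z + heisenberg_bracket y z.
Proof.
congr (_, _, _); rewrite /= ?scaler0 ?addr0 // [in RHS]/GRing.scale /= mulr_sumr.
by rewrite -big_split; apply: eq_bigr => i _ /=; rewrite !mxE; ring.
Qed.

Fact heisenberg_bracketPr (a : R) (x y z : h) :
  heisenberg_bracket z (a *: x + y)
    = a *: heisenberg_bracket z x + heisenberg_bracket z y.
Proof.
congr (_, _, _); rewrite /= ?scaler0 ?addr0 // [in RHS]/GRing.scale /= mulr_sumr.
by rewrite -big_split; apply: eq_bigr => i _ /=; rewrite !mxE; ring.
Qed.

Fact heisenberg_bracketxx (x : h) : heisenberg_bracket x x = 0.
Proof. by congr (_, _, _); apply: big1 => i _; ring. Qed.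

Fact heisenberg_jacobi (x y z : h) :
  heisenberg_bracket x (heisenberg_bracket y z)
    + heisenberg_bracket y (heisenberg_bracket z x)
    + heisenberg_bracket z (heisenberg_bracket x y) = 0.
Proof.
have c u v w : heisenberg_bracket u (heisenberg_bracket v w) = 0.
  by congr (_, _, _); apply: big1 => i _; rewrite !mxE; ring.
by rewrite !c !addr0.
Qed.

HB.instance Definition _ := Vector_isLie.Build R h heisenberg_bracketPl
  heisenberg_bracketPr heisenberg_bracketxx heisenberg_jacobi.
End Heisenberg.

(* Main.v *)
Require Import Defs.
From HB Require Import structures.
From mathcomp Require Import all_boot all_order all_algebra.
From mathcomp Require Import reals.
From mathcomp Require Import sesquilinear complex boolp classical_sets lra.

Set Implicit Arguments.
Unset Strict Implicit.
Unset Printing Implicit Defensive.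

Import Order.TTheory GRing.Theory Num.Theory.
Local Open Scope ring_scope.

(** Evaluated on central elements, non-degeneracy of the CR structure settles
    the first half.  If [phi] is a form with kernel D and z is central, then
    [phi [z, _] = 0]; so a nonzero central z is not in D.  A nilpotent Lie
    algebra has a nonzero centre, hence the Reeb field [eta] of [phi] is a
    multiple of a central element ([nilpotent_reeb]).  The pseudo-Sasakian
    condition only involves ad eta, which vanishes, and n = g / R eta is the
    required central quotient.  Identifying n with D along [eta] turns the CR
    axioms into integrability of J and symmetry of d phi (J _, _), and the
    Jacobi identity of g into closedness of d phi on n
    ([quotient_pseudo_kahler]).

    In the strictly pseudoconvex case the form B = d phi (J _, _) on n is
    positive definite for a suitable sign of [phi], and everything rests on the
    fact that a nilpotent Lie algebra n with a positive definite pseudo-Kähler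
    structure is abelian ([nilpotent_kahler_abelian]).  For z central in n,
    integrability makes A = ad (J z) commute with J, and closedness gives
      B([x, y], z) = B(J A y, x) - B(J A x, y).
    Hence B(A x, z) = 0 for all x.  If A (A x) = 0, apply this to
    A [J x, x] = [A J x, x] + [J x, A x]: the two terms on the right both
    contribute B(A x, A x), so A x = 0.  As A is nilpotent, A = 0, and then the
    same formula shows that z is orthogonal to [n, n].  If n were not abelian,
    some nonzero z would be both central and in [n, n], so B(z, z) = 0.

    When n is abelian, [u, v] = phi [u, v] eta for all u, v in g.  Then g is
    determined by the symplectic form induced on g / R eta, and Darboux
    coordinates for it identify g with the Heisenberg algebra
    ([two_step_heisenberg]). *)

(** * Nilpotent Lie algebras *)

Section Nilpotent.
Variable F : fieldType.
Implicit Types L n : lieAlgType F.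

Lemma lie_bracket_is_linear L (x : L) : linear (lie_bracket x).
Proof. by move=> a y z; rewrite !lie_bracketE. Qed.

HB.instance Definition _ L (x : L) :=
  GRing.isLinear.Build F L L _ (lie_bracket x) (lie_bracket_is_linear x).

Lemma lie_leibniz L (x y z : L) :
  [lie x, [lie y, z]] = [lie [lie x, y], z] + [lie y, [lie x, z]].
Proof.
have /eqP := lie_jacobi x y z; rewrite -addrA addr_eq0 => /eqP ->.
rewrite (lie_anticomm z x) (lie_anticomm z) linearN /= opprD opprK.
by rewrite opprK addrC.
Qed.

Lemma memv_lie_prodv L (U V : {vspace L}) u v :
  u \in U -> v \in V -> [lie u, v] \in lie_prodv U V.
Proof.
move=> /coord_vbasis -> /coord_vbasis ->.
rewrite linear_sum memv_suml // => j _; rewrite linearZ memvZ //=.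
rewrite lie_anticomm linear_sum rpredN memv_suml // => i _.
rewrite linearZ memvZ //= lie_anticomm rpredN memv_span //.
by apply: allpairs_f; rewrite mem_nth ?size_tuple.
Qed.

Lemma lie_prodv_subP L (U V W : {vspace L}) :
  (forall u v, u \in U -> v \in V -> [lie u, v] \in W) -> (lie_prodv U V <= W)%VS.
Proof.
move=> UVW; apply/span_subvP => _ /allpairsP [[u v] /= [Uu Vv ->]].
by apply: UVW; exact: vbasis_mem.
Qed.

Lemma iter_ad_lower_central L (x y : L) k :
  iter k (lie_bracket x) y \in lower_central L k.
Proof.
by elim: k => [|k IHk] /=; rewrite ?memvf // memv_lie_prodv ?memvf.
Qed.

(** The last nonzero term of the lower central series is central; it is a term
    of the series beyond the first one unless the algebra is abelian. *)
Lemma nilpotent_last_term L : lie_nilpotent L -> {:L}%VS != 0%VS ->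
  exists k z, [/\ z != 0, z \in lower_central L k,
                  forall x, [lie z, x] = 0 & k = 0%N -> lie_abelian L].
Proof.
move=> nilL L_neq0.
have exk : exists k, lower_central L k == 0%VS by case: nilL => k /eqP; exists k.
case: (ex_minnP exk) => -[|k] /eqP Lk0 kmin; first by case/eqP: L_neq0.
have Lk x z : z \in lower_central L k -> [lie z, x] = 0.
  move=> Lkz; apply/eqP; rewrite lie_anticomm oppr_eq0 -memv0 -Lk0.
  by rewrite memv_lie_prodv ?memvf.
exists k, (vpick (lower_central L k)); split.
- by rewrite vpick0; apply/negP => /kmin; rewrite ltnn.
- exact: memv_pick.
- by move=> x; apply: Lk; exact: memv_pick.
- by move=> k0 x y; apply: Lk; rewrite k0 memvf.
Qed.

Lemma nilpotent_center L : lie_nilpotent L -> {:L}%VS != 0%VS ->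
  exists2 z : L, z != 0 & forall x, [lie z, x] = 0.
Proof. by move=> nilL /(nilpotent_last_term nilL) [k [z [? _ ? _]]]; exists z. Qed.

Lemma nilpotent_central_commutator L : lie_nilpotent L ->
  lie_abelian L \/
  exists z : L, [/\ z != 0, z \in lie_prodv fullv fullv & forall x, [lie z, x] = 0].
Proof.
move=> nilL; have [L0|] := eqVneq {:L}%VS 0%VS.
  left=> x y; have: [lie x, y] \in {:L}%VS by rewrite memvf.
  by rewrite L0 memv0 => /eqP.
move=> /(nilpotent_last_term nilL) [[|k] [z [z0 Lz Cz ab]]]; first by left; exact: ab.
right; exists z; split=> //; apply: subvP Lz; apply: lie_prodv_subP => u v _ _.
by rewrite memv_lie_prodv ?memvf.
Qed.

Lemma lie_nilpotent_quotient L n (p : 'Hom(L, n)) :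
  lie_hom p -> limg p = fullv -> lie_nilpotent L -> lie_nilpotent n.
Proof.
move=> homp p_onto [k Lk0]; exists k; apply/eqP; rewrite -subv0.
rewrite -(limg0 p) -Lk0 => {Lk0}; elim: k => [|k IHk] /=; first by rewrite p_onto.
apply: lie_prodv_subP => u v; rewrite -p_onto => /memv_imgP [x _ ->].
move=> /(subvP IHk) /memv_imgP [y Ly ->].
by rewrite -homp memv_img // memv_lie_prodv ?memvf.
Qed.

End Nilpotent.

(** * Positive definite Kähler structures on nilpotent Lie algebras *)

Section Kahler.
Variables (R : realType) (n : lieAlgType R) (J : 'End(n)) (B : {symmetric n}).
Hypothesis J2 : forall x, J (J x) = - x.
Hypothesis JN : forall x y, nijenhuis J x y = 0.
Hypothesis Bskew : forall x y, B (J x) y = - B x (J y).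
Hypothesis omega_closed : closed2 (fun x y => B (J x) y).
Hypothesis Bpos : forall x, x != 0 -> 0 < B x x.

Let BJJ x y : B (J x) (J y) = B x y.
Proof. by rewrite Bskew J2 linearNr opprK. Qed.

Let B_eq0 x : B x x = 0 -> x = 0.
Proof. by move=> Bx; apply: contra_eq Bx => /Bpos; rewrite lt0r => /andP[]. Qed.

Section CentralElement.
Variable z : n.
Hypothesis zC : forall x, [lie z, x] = 0.

Let A x := [lie J z, x].

Let AJ x : A (J x) = J (A x).
Proof.
apply/eqP; rewrite -subr_eq0; apply/eqP.
by have := JN z x; rewrite /nijenhuis !zC linear0 !subr0.
Qed.

(* This is d omega = 0 evaluated on (J z, x, y). *)
Let dzetaE x y : B [lie x, y] z = B (J (A y)) x - B (J (A x)) y.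
Proof.
have := omega_closed (J z) x y.
rewrite BJJ (lie_anticomm y) linearN /= linearNl -/(A x) -/(A y) /=.
set p := B _ y; set q := B _ z; set r := B _ x; lra.
Qed.

(** Set y = z in the formula for [B [lie x, y] z]: every bracket with z
    vanishes, and a single term survives. *)
Lemma kahler_ad_Jcenter_perp x : B (A x) z = 0.
Proof.
have zr y : [lie y, z] = 0 by rewrite lie_anticomm zC oppr0.
have := dzetaE (J x) z; rewrite zr /A zr linear0 !linear0l sub0r -/(A _) AJ J2.
by rewrite linearNl opprK.
Qed.

(** The key step: the derivation property of A on [lie J x, x] expresses
    twice B(A x, A x) as the pairing with z of an element of the image of A. *)
Lemma kahler_ad_Jcenter_sqr x : A (A x) = 0 -> A x = 0.
Proof.
move=> AAx; apply: B_eq0.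
have := kahler_ad_Jcenter_perp [lie J x, x].
rewrite {1}/A lie_leibniz linearDl /= -!/(A _). rewrite !dzetaE.
rewrite !AJ !J2 AAx oppr0 linear0 !linear0l linearNl /= BJJ.
lra.
Qed.

(** Since A is nilpotent and ker A^2 = ker A, it vanishes, and A governs the
    pairing of z with commutators. *)
Lemma kahler_center_perp : lie_nilpotent n ->
  (lie_prodv fullv fullv <= orthov B <[z]>)%VS.
Proof.
move=> [k nk0].
have A0 x : A x = 0.
  have : iter k A x = 0.
    by apply/eqP; rewrite -memv0 -nk0; exact: iter_ad_lower_central.
  elim: k {nk0} => [/= ->|k IHk]; first by rewrite /A linear0.
  case: k IHk => [//|k] IHk /= /kahler_ad_Jcenter_sqr; exact: IHk.
apply: lie_prodv_subP => u v _ _.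
by rewrite mem_orthov1 dzetaE !A0 linear0 !linear0l subrr.
Qed.
End CentralElement.

Lemma nilpotent_kahler_abelian : lie_nilpotent n -> lie_abelian n.
Proof.
move=> niln; have [//|[z [z0 nnz zC]]] := nilpotent_central_commutator niln.
have := subvP (kahler_center_perp zC niln) _ nnz.
by rewrite mem_orthov1 gt_eqF // Bpos.
Qed.

End Kahler.

(** * Darboux coordinates *)

Section Darboux.
Variables (R : realType) (g : lieAlgType R) (phi : 'Hom(g, R^o)) (eta : g).
Hypothesis phi_eta : phi eta = 1.
Hypothesis etaC : forall u, [lie eta, u] = 0.
Hypothesis nondeg : forall u, phi u = 0 -> (forall v, phi [lie u, v] = 0) -> u = 0.

Definition symplectic_family k (x y : nat -> g) : Prop :=
  forall i j, (i < k)%N -> (j < k)%N ->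
    [/\ phi [lie x i, x j] = 0, phi [lie y i, y j] = 0
      & phi [lie x i, y j] = (i == j)%:R].

(** The coordinates of u in the Darboux basis, with values in the Heisenberg
    algebra.  The last one is - phi because [X_i, Y_i] = - Z there, whereas
    [x_i, y_i] = eta when [g, g] is spanned by [eta]. *)
Definition darboux k (x y : nat -> g) (u : g) : heisenberg R k :=
  (\row_(i < k) phi [lie u, y i], \row_(i < k) phi [lie x i, u], - phi u).

(** A right inverse of [darboux]: the combination w of the x_i and y_i with
    the given coordinates, corrected along [eta] to have the right value of
    [phi]. *)
Definition darboux_comb k (x y : nat -> g) (r : heisenberg R k) : g :=
  let w := \sum_(i < k) (r.1.1 0 i *: x i + r.1.2 0 i *: y i) in
  w - (r.2 + phi w) *: eta.

Fact darboux_is_linear k x y : linear (@darboux k x y).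
Proof.
move=> a u v; congr (_, _, _); last by rewrite linearP /= opprD -mulrN.
- by apply/rowP => i; rewrite !mxE lie_bracketPl linearP.
- by apply/rowP => i; rewrite !mxE lie_bracketPr linearP.
Qed.

HB.instance Definition _ k x y := GRing.isLinear.Build R g (heisenberg R k) _
  (@darboux k x y) (@darboux_is_linear k x y).

Lemma phi_darboux_comb k x y (r : heisenberg R k) v :
  phi [lie darboux_comb x y r, v]
    = \sum_(i < k) (r.1.1 0 i * phi [lie x i, v] + r.1.2 0 i * phi [lie y i, v]).
Proof.
rewrite /darboux_comb lie_bracketDl lie_bracketNl lie_bracketZl etaC scaler0 subr0.
rewrite lie_anticomm linear_sum -sumrN linear_sum; apply: eq_bigr => i _.
by rewrite -lie_anticomm lie_bracketDl !lie_bracketZl linearD !linearZ.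
Qed.

Lemma darboux_combK k x y : symplectic_family k x y ->
  cancel (@darboux_comb k x y) (darboux k x y).
Proof.
move=> xy [[a b] c]; congr (_, _, _).
- apply/rowP => j; rewrite mxE phi_darboux_comb (bigD1 j) //= big1 => [|i ij].
    by case: (xy j j) => // _ -> ->; rewrite eqxx mulr1 mulr0 !addr0.
  case: (xy i j) => // _ -> ->; rewrite (negbTE ij : (val i == val j) = false).
  by rewrite !mulr0 addr0.
- apply/rowP => j; rewrite mxE lie_anticomm linearN /= phi_darboux_comb.
  rewrite (bigD1 j) //= big1 => [|i ij].
    case: (xy j j) => // -> _; rewrite (lie_anticomm (y j)) linearN /= => ->.
    by rewrite eqxx mulr0 add0r addr0 mulrN1 opprK.
  case: (xy i j) => // -> _ _; rewrite (lie_anticomm (y i)) linearN /=.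
  case: (xy j i) => // _ _ ->; rewrite eq_sym (negbTE ij : (val i == val j) = false).
  by rewrite oppr0 !mulr0 addr0.
- by rewrite /darboux_comb linearB linearZ /= phi_eta [_ *: _]mulr1 opprB addrK.
Qed.

Lemma dim_heisenberg k : \dim {:heisenberg R k} = k.*2.+1.
Proof.
by rewrite dimvf -addnn -addn1 -[in RHS](mul1n k).
Qed.

Lemma dim_ker_darboux k x y : symplectic_family k x y ->
  (\dim (lker (linfun (darboux k x y))) + k.*2.+1)%N = \dim {:g}.
Proof.
move=> xy; rewrite -(limg_ker_dim (linfun (darboux k x y)) fullv) capfv.
congr (_ + _)%N; rewrite -dim_heisenberg; congr (\dim _).
apply/eqP; rewrite eqEsubv subvf andbT; apply/subvP => r _.
by rewrite -(darboux_combK xy r) -(lfunE (darboux k x y)) memv_img // memvf.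
Qed.

(** The coordinate map of the family is onto a space of dimension 2k + 1, so it
    kills some w <> 0.  Non-degeneracy gives v with phi [w, v] <> 0;
    subtracting its components along the family and rescaling makes (w, v) a
    new symplectic pair. *)
Lemma symplectic_family_extend k x y : symplectic_family k x y ->
  (k.*2.+1 < \dim {:g})%N -> exists x' y', symplectic_family k.+1 x' y'.
Proof.
move=> xy; rewrite -(dim_ker_darboux xy) -{1}(add0n k.*2.+1) ltn_add2r lt0n dimv_eq0.
rewrite -vpick0; set w := vpick _ => w0.
have : w \in lker (linfun (darboux k x y)) by exact: memv_pick.
rewrite memv_ker lfunE /= => /eqP [/rowP wy /rowP xw /eqP].
rewrite oppr_eq0 => /eqP phiw.
have {}wy i : (i < k)%N -> phi [lie w, y i] = 0.
  by move=> ik; have := wy (Ordinal ik); rewrite !mxE.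
have {}xw i : (i < k)%N -> phi [lie x i, w] = 0.
  by move=> ik; have := xw (Ordinal ik); rewrite !mxE.
have [v wv] : exists v, phi [lie w, v] <> 0.
  by apply/existsNP => wv; case/eqP: w0; exact: nondeg.
(* The new partner of w; it pairs with w to 1 since w is orthogonal to the
   whole family and to eta. *)
pose v1 := (phi [lie w, v])^-1 *: (v - darboux_comb x y (darboux k x y v)).
have : darboux k x y v1 = 0.
  by rewrite linearZ linearB /= darboux_combK // subrr scaler0.
move=> [/rowP v1y /rowP xv1 _].
have {}v1y i : (i < k)%N -> phi [lie v1, y i] = 0.
  by move=> ik; have := v1y (Ordinal ik); rewrite !mxE.
have {}xv1 i : (i < k)%N -> phi [lie x i, v1] = 0.
  by move=> ik; have := xv1 (Ordinal ik); rewrite !mxE.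
have wv1 : phi [lie w, v1] = 1.
  rewrite /v1 lie_bracketZr linearZ lie_bracketDr lie_bracketNr linearB /=.
  rewrite (lie_anticomm w (darboux_comb _ _ _)) linearN /= phi_darboux_comb.
  rewrite big1 ?oppr0; first by rewrite addr0 [LHS]mulVf //; exact/eqP.
  move=> i _; rewrite xw // mulr0 (lie_anticomm (y i)) linearN /= wy //.
  by rewrite oppr0 mulr0 addr0.
exists (fun i => if i == k then w else x i), (fun i => if i == k then v1 else y i).
move=> i j; rewrite !ltnS (leq_eqVlt i) (leq_eqVlt j).
have [->|ik] /= := eqVneq i k; have [->|jk] /= := eqVneq j k => //.
- by move=> _ _; rewrite !lie_bracketxx !linear0 wv1.
- move=> _ jk'; rewrite v1y ?wy // (lie_anticomm w) linearN /= xw // oppr0.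
  by split=> //; rewrite eq_sym (negbTE jk).
- move=> ik' _; rewrite xw // xv1 // (lie_anticomm (y i)) linearN /= v1y // oppr0.
  by split=> //; rewrite (negbTE ik).
- exact: xy.
Qed.

(** Once the symplectic family has m pairs, the coordinate map is injective by
    dimension, and it is a homomorphism because [phi [lie u, v]] is computed
    from the coordinates of u. *)
Lemma two_step_heisenberg m : \dim {:g} = m.*2.+1 ->
  (forall u v, [lie u, v] = phi [lie u, v] *: eta) ->
  lie_isomorphic g (heisenberg R m).
Proof.
move=> dimg derg.
have [x [y xy]] : exists x y, symplectic_family m x y.
  have: (m <= m)%N by []; elim: {1 3}m => [|k IHk] km.
    by exists (fun=> 0), (fun=> 0).
  have [x [y xy]] := IHk (ltnW km).
  by apply: (symplectic_family_extend xy); rewrite dimg ltnS ltn_double.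
have ker0 : lker (linfun (darboux m x y)) == 0%VS.
  by rewrite -dimv_eq0 -(eqn_add2r m.*2.+1) dim_ker_darboux // dimg.
have darbouxK u : darboux_comb x y (darboux m x y u) = u.
  by move/lker0P: (ker0) => inj; apply: inj; rewrite !lfunE /= darboux_combK.
exists (linfun (darboux m x y)); split; last 2 first.
- exact/eqP.
- apply/eqP; rewrite eqEdim subvf dim_heisenberg limg_dim_eq ?dimg ?leqnn //.
  rewrite capfv; exact/eqP.
move=> u v; rewrite !lfunE /=; congr (_, _, _).
- by apply/rowP => i; rewrite !mxE (derg u v) lie_bracketZl etaC scaler0 linear0.
- apply/rowP => i; rewrite !mxE (derg u v) lie_bracketZr (lie_anticomm (x i) eta).
  by rewrite etaC oppr0 scaler0 linear0.
rewrite -{1}(darbouxK u) phi_darboux_comb -sumrN; apply: eq_bigr => i _ /=.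
by rewrite !mxE (lie_anticomm (y i)) linearN /= opprD mulrN opprK addrC.
Qed.

End Darboux.

(** * The quotient by a central Reeb field *)

Section ContactQuotient.
Variables (F : fieldType) (g : lieAlgType F) (D : {vspace g}).
Variables (phi : 'Hom(g, F^o)) (eta : g).

Definition along_reeb (x : g) : subvs_of D := vsproj D (x - (phi x : F) *: eta).

Fact along_reeb_is_linear : linear along_reeb.
Proof.
move=> a x y; rewrite /along_reeb -linearP; congr (vsproj D _).
by rewrite linearP /= scalerBr scalerDl opprD addrACA scalerA.
Qed.

HB.instance Definition _ := GRing.isLinear.Build F g (subvs_of D) _
  along_reeb along_reeb_is_linear.

Hypothesis ker_phi : lker phi = D.
Hypothesis phi_eta : phi eta = 1.
Hypothesis etaC : forall u, [lie eta, u] = 0.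

Lemma along_reebE x : vsval (along_reeb x) = x - (phi x : F) *: eta.
Proof.
rewrite vsprojK // -ker_phi memv_ker linearB linearZ /= phi_eta.
by rewrite [_ *: _]mulr1 subrr.
Qed.

Lemma phi_vsval (x : subvs_of D) : phi (vsval x) = 0.
Proof. by apply/eqP; rewrite -memv_ker ker_phi subvsP. Qed.

Lemma along_reeb_vsproj x : phi x = 0 -> along_reeb x = vsproj D x.
Proof. by rewrite /along_reeb => ->; rewrite scale0r subr0. Qed.

Lemma along_reebK (x : subvs_of D) : along_reeb (vsval x) = x.
Proof. by rewrite along_reeb_vsproj ?vsvalK // phi_vsval. Qed.

Lemma along_reeb_eta : along_reeb eta = 0.
Proof. by apply: subvs_inj; rewrite along_reebE phi_eta scale1r subrr linear0. Qed.

Lemma bracket_along_reebl x y : [lie vsval (along_reeb x), y] = [lie x, y].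
Proof. by rewrite along_reebE !lie_bracketE etaC scaler0 subr0. Qed.

Lemma bracket_along_reebr x y : [lie y, vsval (along_reeb x)] = [lie y, x].
Proof. by rewrite lie_anticomm bracket_along_reebl -lie_anticomm. Qed.

(** The underlying space of g / F eta, realised as the complement D of [eta],
    so that J is literally an endomorphism of it. *)
Definition contact_quotient : Type := subvs_of D.

HB.instance Definition _ := Vector.on contact_quotient.

Definition contact_bracket (x y : contact_quotient) : contact_quotient :=
  along_reeb [lie vsval x, vsval y].

Fact contact_bracketPl a (x y z : contact_quotient) :
  contact_bracket (a *: x + y) z = a *: contact_bracket x z + contact_bracket y z.
Proof. by rewrite /contact_bracket -linearP -lie_bracketPl. Qed.

Fact contact_bracketPr a (x y z : contact_quotient) :
  contact_bracket z (a *: x + y) = a *: contact_bracket z x + contact_bracket z y.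
Proof. by rewrite /contact_bracket -linearP -lie_bracketPr. Qed.

Fact contact_bracketxx x : contact_bracket x x = 0.
Proof. by rewrite /contact_bracket lie_bracketxx linear0. Qed.

Fact contact_jacobi x y z :
  contact_bracket x (contact_bracket y z) + contact_bracket y (contact_bracket z x)
    + contact_bracket z (contact_bracket x y) = 0.
Proof.
by rewrite /contact_bracket !bracket_along_reebr -!linearD lie_jacobi linear0.
Qed.

Definition contact_quotient_lie : lieAlgType F :=
  HB.pack contact_quotient (Vector_isLie.Build F contact_quotient
    contact_bracketPl contact_bracketPr contact_bracketxx contact_jacobi).

Lemma contact_bracketE (x y : contact_quotient_lie) :
  [lie x, y] = along_reeb [lie vsval x, vsval y].
Proof. by []. Qed.

Definition contact_proj : 'Hom(g, contact_quotient_lie) := linfun along_reeb.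

Lemma contact_proj_hom : lie_hom contact_proj.
Proof.
move=> x y; rewrite !lfunE /= contact_bracketE.
by rewrite bracket_along_reebl bracket_along_reebr.
Qed.

Lemma contact_proj_onto : limg contact_proj = fullv.
Proof.
apply/eqP; rewrite eqEsubv subvf; apply/subvP => x _.
by rewrite -[x]along_reebK -(lfunE along_reeb) memv_img // memvf.
Qed.

Lemma contact_central_extension : central_extension g contact_quotient_lie.
Proof.
have [i iE] : exists i : 'Hom(F^o, g), forall a : F, i a = a *: eta.
  have lin_eta : linear (fun a : F^o => (a : F) *: eta).
    by move=> a x y; rewrite scalerDl scalerA.
  pose etaL := GRing.isLinear.Build F F^o g _ _ lin_eta.
  pose i0 : {linear F^o -> g} := HB.pack (fun a : F^o => (a : F) *: eta) etaL.
  by exists (linfun i0) => a; exact: lfunE.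
exists i, contact_proj; split.
- exact: contact_proj_hom.
- apply/eqP/lker0P => a b; rewrite !iE => /(congr1 phi).
  by rewrite !linearZ /= phi_eta ![_ *: _]mulr1.
- apply/vspaceP => x; apply/memv_imgP/idP => [[a _ ->]|].
    by rewrite memv_ker iE lfunE /= linearZ /= along_reeb_eta scaler0.
  rewrite memv_ker lfunE /= => /eqP px; exists (phi x); first exact: memvf.
  by rewrite iE; apply/eqP; rewrite -subr_eq0 -along_reebE px linear0.
- exact: contact_proj_onto.
- by move=> a x; rewrite iE lie_bracketZl etaC scaler0.
Qed.

End ContactQuotient.

(** * Contact forms of non-degenerate CR structures *)

Lemma hyperplane_form (F : fieldType) (V : vectType F) (U : {vspace V}) :
  \dim {:V} = (\dim U).+1 -> exists phi : 'Hom(V, F^o), lker phi = U.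
Proof.
move=> dimU; have dimC : \dim (U^C) = 1%N by rewrite dimv_compl dimU subSnn.
pose X := vbasis U^C; pose P := daddv_pi U^C U.
pose i := cast_ord (esym dimC) ord0.
have i_uniq j : j = i by apply: val_inj; case: j => -[|j] //=; rewrite dimC.
exists (linfun (coord X i : V -> F^o) \o P)%VF; apply/vspaceP => x.
have xE : P x + daddv_pi U U^C x = x.
  apply: daddv_pi_add; first by rewrite capvC capv_compl.
  by rewrite addvC addv_complf memvf.
have -> : (x \in U) = (P x == 0).
  apply/idP/eqP => [xU|Px]; last by rewrite -xE Px add0r memv_pi.
  by move/(canRL (addrK _)): xE; rewrite daddv_pi_id ?capv_compl // subrr.
rewrite memv_ker comp_lfunE lfunE /=; apply/eqP/eqP => [cx|->]; last by rewrite linear0.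
rewrite (coord_vbasis (memv_pi U^C U x)) big1 // => j _.
by rewrite (i_uniq j) cx scale0r.
Qed.

Section ContactForm.
Variables (R : realType) (g : lieAlgType R) (cr : cr_structure g).
Local Notation D := (cr_D cr).
Local Notation J := (cr_J cr).

(** k and its conjugate span D + i D: the pair (x, y) is the sum of the element
    of k given by (x + J y) / 2 and the conjugate of that given by
    (x - J y) / 2. *)
Lemma cr_DCP x y : x \in D -> y \in D -> cr_DC cr ((x, y) : complexification R g).
Proof.
move=> xD yD; pose X := vsproj D x; pose Y := vsproj D y.
have half (u : subvs_of D) : 2^-1 *: (u + u) = u.
  by rewrite -mulr2n -scaler_nat scalerA mulVf ?scale1r ?pnatr_eq0.
pose U := 2^-1 *: (X + J Y); pose V := 2^-1 *: (X - J Y).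
have UV : U + V = X by rewrite -scalerDr addrACA subrr addr0 half.
have JVU : J V - J U = Y.
  rewrite -linearB /= -scalerBr opprD addrACA subrr add0r -opprD.
  by rewrite linearZ linearN linearD /= cr_J2 -opprD opprK half.
exists (vsval U, - vsval (J U)); first by exists U.
exists (vsval V, vsval (J V)).
  exists (vsval V, - vsval (J V)); first by exists V.
  by rewrite /cplx_conj /= opprK.
congr pair; first exact: etrans (congr1 vsval UV) (vsprojK xD).
by rewrite /= addrC; exact: etrans (congr1 vsval JVU) (vsprojK yD).
Qed.

Variable phi : 'Hom(g, R^o).
Hypothesis ker_phi : lker phi = D.

Let phi0 X : X \in D -> phi X = 0.
Proof. by rewrite -ker_phi memv_ker => /eqP. Qed.

Let memD X : phi X = 0 -> X \in D.
Proof. by rewrite -ker_phi memv_ker => ->. Qed.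

Lemma phi_levi (X Y : subvs_of D) :
  phi [lie vsval (J X), vsval Y] = - phi [lie vsval X, vsval (J Y)].
Proof. by apply/eqP; rewrite -addr_eq0 -linearD /= phi0 ?cr_Levi. Qed.

Hypothesis nondeg : cr_nondegenerate cr.

(** For z = X - i J X and w = Y - i J Y, the real and imaginary parts of
    [z, conj w] only involve brackets of X and J X with D; by the Levi condition
    these all lie in D as soon as phi [X, _] = 0. *)
Lemma contact_nondegenerate X : phi X = 0 -> (forall Y, phi [lie X, Y] = 0) -> X = 0.
Proof.
move=> /memD XD dphiX.
have [x xX] : exists x : subvs_of D, vsval x = X by exists (vsproj D X); rewrite vsprojK.
rewrite -{}xX in XD dphiX *.
have dphiJX (y : subvs_of D) : phi [lie vsval (J x), vsval y] = 0.
  by rewrite phi_levi dphiX oppr0.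
suff [] : (vsval x, - vsval (J x)) = 0 :> complexification R g by [].
apply: nondeg; first by exists x.
move=> _ [y _ <-]; rewrite /levi.
set z := (X in cr_DC _ X).
have -> : z = ([lie vsval x, vsval (J y)] - [lie vsval (J x), vsval y],
               - ([lie vsval x, vsval y] + [lie vsval (J x), vsval (J y)])).
  rewrite /z; congr pair; rewrite /= !lie_bracketE /= ?opprK ?scale0r ?scale1r.
  - by rewrite sub0r opprK.
  - by rewrite add0r.
apply: cr_DCP; apply: memD; first by rewrite linearB /= dphiX dphiJX subrr.
by rewrite linearN linearD /= dphiX dphiJX addr0 oppr0.
Qed.

(** Real and imaginary parts of [X - i J X, X + i J X] are 0 and 2 [X, J X]. *)
Lemma cplx_form_levi (x : subvs_of D) (z := (vsval x, - vsval (J x))) :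
  cplx_form phi (levi (z : complexification R g) z)
    = Complex (2 * phi [lie vsval x, vsval (J x)]) 0.
Proof.
have -> : levi (z : complexification R g) z = (2 *: [lie vsval x, vsval (J x)], 0).
  congr pair; rewrite /= !lie_bracketE !lie_bracketxx /= !opprK ?scale0r ?scale1r.
    by rewrite (lie_anticomm (vsval (J x))) opprK sub0r opprK scaler_nat mulr2n.
  by rewrite !addr0 oppr0.
by rewrite /cplx_form /= linearZ linear0.
Qed.

End ContactForm.

Section NilpotentCR.
Variables (R : realType) (g : lieAlgType R) (cr : cr_structure g).
Local Notation D := (cr_D cr).
Local Notation J := (cr_J cr).
Hypotheses (nilg : lie_nilpotent g) (nondeg : cr_nondegenerate cr).

(** By non-degeneracy, a nonzero central element is not in D; rescaled, it is
    the Reeb field. *)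
Lemma nilpotent_reeb (phi : 'Hom(g, R^o)) : lker phi = D ->
  exists2 eta, phi eta = 1 & forall u, [lie eta, u] = 0.
Proof.
move=> ker_phi; have [|z z0 zC] := nilpotent_center nilg.
  by rewrite -dimv_eq0 (cr_codim1 cr).
have phiz : phi z != 0.
  apply: contraNneq z0 => phiz; apply/eqP.
  by apply: (contact_nondegenerate ker_phi nondeg phiz) => u; rewrite zC linear0.
exists ((phi z : R)^-1 *: z); first by rewrite linearZ /= [LHS]mulVf.
by move=> u; rewrite lie_bracketZl zC scaler0.
Qed.

Section Reeb.
Variables (phi : 'Hom(g, R^o)) (eta : g).
Hypothesis ker_phi : lker phi = D.
Hypothesis phi_eta : phi eta = 1.
Hypothesis etaC : forall u, [lie eta, u] = 0.

Lemma is_reeb_central : is_reeb phi eta.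
Proof. by split=> // u; rewrite /lie_d etaC linear0 oppr0. Qed.

Lemma reeb_unique eta' : is_reeb phi eta' -> eta = eta'.
Proof.
case=> phi_eta' deta'; apply/eqP; rewrite -subr_eq0; apply/eqP.
apply: (contact_nondegenerate ker_phi nondeg).
  by rewrite linearB /= phi_eta phi_eta' subrr.
move=> u; rewrite lie_bracketDl lie_bracketNl etaC sub0r linearN /=.
exact: deta'.
Qed.

Local Notation n := (contact_quotient_lie ker_phi phi_eta etaC).

(** The bilinear form d phi (J _, _) on D, which is the transverse part of
    [cr_metric]. *)
Definition quotient_form (x y : subvs_of D) : R := lie_d phi (vsval (J x)) (vsval y).

Let quotient_formC x y : quotient_form x y = quotient_form y x.
Proof.
rewrite /quotient_form /lie_d (phi_levi ker_phi) opprK.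
by rewrite (lie_anticomm (vsval (J y))) linearN /= opprK.
Qed.

Let quotient_form_linear y : linear_for *%R (quotient_form y).
Proof.
move=> a x x'; rewrite /quotient_form /lie_d.
rewrite [vsval (a *: x + x')]linearP lie_bracketPr linearP /=.
by rewrite opprD -[_ *: _]/(_ * _) mulrN.
Qed.

(** The Levi condition is the symmetry of [quotient_form]. *)
Lemma quotient_symmetric_form :
  {B : {symmetric n} | forall x y, B x y = quotient_form x y}.
Proof.
have bil : bilinear_for *%R (idfun \; *%R) (quotient_form : n -> n -> R).
  split=> y a x x'; last exact: quotient_form_linear.
  by rewrite !(quotient_formC _ y); exact: quotient_form_linear.
have herm : forall x y : n, quotient_form x y = (-1) ^+ false * idfun (quotient_form y x).
  by move=> x y; rewrite expr0 mul1r quotient_formC.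
pose b1 := bilinear_isBilinear.Build R n n R _ _ _ bil.
pose b2 := isHermitianSesquilinear.Build R n _ _ _ herm.
pose B : {symmetric n} := HB.pack (quotient_form : n -> n -> R) b1 b2.
by exists B.
Qed.

(** The integrability condition of the CR structure, projected along [eta]. *)
Lemma quotient_nijenhuis (x y : n) : nijenhuis (J : 'End(n)) x y = 0.
Proof.
have p0 : phi ([lie vsval x, vsval (J y)] + [lie vsval (J x), vsval y]) = 0.
  by rewrite linearD /= (phi_levi ker_phi) subrr.
have := congr1 (along_reeb D phi eta) (cr_integrable x y).
rewrite linear0 !linearB /= (along_reebK eta ker_phi) -(along_reeb_vsproj D eta p0).
rewrite !linearD /= => int0; rewrite -[RHS]int0 /nijenhuis !contact_bracketE.
set a := along_reeb _ _ _ _.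
set b := J (along_reeb _ _ _ _); set c := J (along_reeb _ _ _ _).
set d := along_reeb _ _ _ _.
by rewrite [X in _ = _ + X]addrC [RHS]addrAC addrA.
Qed.

Lemma quotient_omega x y : quotient_form (J x) y = phi [lie vsval x, vsval y].
Proof. by rewrite /quotient_form /lie_d cr_J2 linearN lie_bracketNl linearN /= opprK. Qed.

Lemma quotient_form_skew x y : quotient_form (J x) y = - quotient_form x (J y).
Proof.
by rewrite quotient_omega /quotient_form /lie_d (phi_levi ker_phi) cr_J2 linearN
  lie_bracketNr linearN /= !opprK.
Qed.

(** Up to sign the 2-form is d phi, and its closedness is [phi] applied to the
    Jacobi identity of g. *)
Lemma quotient_omega_closed : closed2 (fun x y : n => quotient_form (J x) y).
Proof.
have omega_bracket (x y z : n) :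
    quotient_form (J [lie x, y]) z = - phi [lie vsval z, [lie vsval x, vsval y]].
  rewrite quotient_omega contact_bracketE (bracket_along_reebl ker_phi phi_eta etaC).
  by rewrite lie_anticomm linearN.
move=> x y z; rewrite !omega_bracket.
have := congr1 phi (lie_jacobi (vsval x) (vsval y) (vsval z)).
rewrite linear0 !linearD /= => jac.
by rewrite -!opprD -[RHS]oppr0 -[in RHS]jac; congr (- _); rewrite -addrA addrC.
Qed.

Lemma quotient_form_nondegenerate x : (forall y, quotient_form x y = 0) -> x = 0.
Proof.
move=> dx; apply: oppr_inj; rewrite -(cr_J2 x) oppr0.
suff -> : J x = 0 by rewrite linear0.
apply: subvs_inj; apply: (contact_nondegenerate ker_phi nondeg).
  exact: phi_vsval.
move=> y; rewrite -(bracket_along_reebr ker_phi phi_eta etaC).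
by apply: oppr_inj; rewrite oppr0; exact: dx.
Qed.

Lemma lie_nilpotent_contact_quotient : lie_nilpotent n.
Proof.
exact: lie_nilpotent_quotient (contact_proj_hom _ _ _) (contact_proj_onto _ _ _) nilg.
Qed.

Lemma quotient_pseudo_kahler m : \dim {:g} = m.*2.+1 -> pseudo_kahler n.
Proof.
move=> dimg; have [B BE] := quotient_symmetric_form; split.
  have -> : \dim {:n} = \dim D by rewrite dimvf.
  by have := cr_codim1 cr; rewrite dimg => -[<-]; rewrite odd_double.
exists (J : 'End(n)), B; split.
- exact: cr_J2.
- exact: quotient_nijenhuis.
- rewrite /nondegenerate -subv0; apply/subvP => x /mem_orthovP Bx.
  rewrite memv0; apply/eqP/quotient_form_nondegenerate => y.
  by rewrite -BE Bx ?memvf.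
- by move=> x y; rewrite !BE quotient_form_skew.
- by move=> x y z; rewrite !BE; exact: quotient_omega_closed.
Qed.

Lemma cr_metricE x y :
  cr_metric cr phi eta x y
    = phi x * phi y + quotient_form (along_reeb D phi eta x) (along_reeb D phi eta y).
Proof.
rewrite /cr_metric /quotient_form /lie_d.
by rewrite (bracket_along_reebr ker_phi phi_eta etaC).
Qed.

Lemma cr_metric_reeb x y :
  cr_metric cr phi eta [lie eta, x] y + cr_metric cr phi eta x [lie eta, y] = 0.
Proof.
rewrite !cr_metricE !etaC !linear0 mul0r mulr0 /quotient_form /lie_d !linear0.
by rewrite lie_bracket0l linear0 oppr0 !addr0.
Qed.

Section Positive.
Hypothesis form_pos : forall x, x != 0 -> 0 < quotient_form x x.

Lemma cr_metric_pos x : x != 0 -> 0 < cr_metric cr phi eta x x.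
Proof.
move=> x0; rewrite cr_metricE; set p := along_reeb _ _ _ _.
have [p0|/form_pos pp] := eqVneq p 0; last by rewrite ltr_wpDl // -expr2 sqr_ge0.
have xE : x = phi x *: eta.
  by apply/eqP; rewrite -subr_eq0 -(along_reebE ker_phi phi_eta) -/p p0 linear0.
rewrite p0 /quotient_form /lie_d !linear0 addr0.
rewrite lt_def mulf_eq0 orbb -expr2 sqr_ge0 andbT.
by apply: contraNneq x0 => px; rewrite xE px scale0r.
Qed.

(** The quotient carries a positive definite Kähler structure, hence is
    abelian, so brackets in g only have a component along [eta]. *)
Lemma positive_bracketE u v : [lie u, v] = phi [lie u, v] *: eta.
Proof.
have [B BE] := quotient_symmetric_form.
have abn : lie_abelian n.
  apply: (@nilpotent_kahler_abelian _ n (J : 'End(n)) B).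
  - exact: cr_J2.
  - exact: quotient_nijenhuis.
  - by move=> x y; rewrite !BE quotient_form_skew.
  - by move=> x y z; rewrite !BE; exact: quotient_omega_closed.
  - by move=> x; rewrite BE; exact: form_pos.
  - exact: lie_nilpotent_contact_quotient.
apply/eqP; rewrite -subr_eq0 -(along_reebE ker_phi phi_eta).
have := contact_proj_hom ker_phi phi_eta etaC u v; rewrite abn lfunE /= => ->.
by rewrite linear0.
Qed.

End Positive.
End Reeb.
End NilpotentCR.

(** The Levi form of X - i J X is twice d phi (J X, X); in the negative case
    replace phi by - phi. *)
Lemma strictly_pseudoconvex_form (R : realType) (g : lieAlgType R) (cr : cr_structure g) :
  strictly_pseudoconvex cr ->
  exists2 phi, lker phi = cr_D cr &
    forall x : subvs_of (cr_D cr), x != 0 -> 0 < quotient_form phi x x.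
Proof.
move=> [phi ker_phi levi_sgn].
pose z (x : subvs_of (cr_D cr)) : complexification R g :=
  (vsval x, - vsval (cr_J cr x)).
have kz x : cr_k cr (z x) by exists x.
have z0 x : x != 0 -> z x != 0.
  by apply: contra_neq => -[x0 _]; apply: subvs_inj; rewrite x0 linear0.
case: levi_sgn => sgn.
- exists phi => // x x0; have := sgn _ (kz x) (z0 x x0).
  rewrite cplx_form_levi ltcE /= => /andP[_].
  by rewrite pmulr_rgt0 // /quotient_form /lie_d (phi_levi ker_phi) opprK.
- exists (- phi).
    by apply/vspaceP => u; rewrite memv_ker opp_lfunE oppr_eq0 -memv_ker ker_phi.
  move=> x x0; have := sgn _ (kz x) (z0 x x0).
  rewrite cplx_form_levi ltcE /= => /andP[_].
  rewrite pmulr_rlt0 // /quotient_form /lie_d opp_lfunE opprK (phi_levi ker_phi).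
  by rewrite oppr_gt0.
Qed.

(** The quotient is the abelian algebra of the pairs (x, y). *)
Lemma heisenberg_central_extension (R : realType) m :
  exists a : lieAlgType R, lie_abelian a /\ central_extension (heisenberg R m) a.
Proof.
pose V : vectType R := ('rV[R]_m * 'rV[R]_m)%type.
pose br (x y : V) : V := 0.
have brl (a : R) (x y z : V) : br (a *: x + y) z = a *: br x z + br y z.
  by rewrite /br scaler0 addr0.
have brr (a : R) (x y z : V) : br z (a *: x + y) = a *: br z x + br z y.
  by rewrite /br scaler0 addr0.
have brJ (x y z : V) : br x (br y z) + br y (br z x) + br z (br x y) = 0.
  by rewrite /br !addr0.
pose a : lieAlgType R := HB.pack V
  (Vector_isLie.Build R V brl brr (fun=> erefl) brJ).
exists a; split=> //.
pose i0 (c : R^o) : heisenberg R m := (0, c).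
have lin_i : linear i0 by move=> k x y; congr pair; rewrite /= scaler0 addr0.
pose i : {linear R^o -> heisenberg R m} :=
  HB.pack i0 (GRing.isLinear.Build R _ _ _ _ lin_i).
have lin_p : linear (fst : heisenberg R m -> a) by [].
pose p : {linear heisenberg R m -> a} :=
  HB.pack (fst : heisenberg R m -> a) (GRing.isLinear.Build R _ _ _ _ lin_p).
have iE c : linfun i c = (0, c) by rewrite lfunE.
have pE u : linfun p u = u.1 by rewrite lfunE.
exists (linfun i), (linfun p); split.
- by move=> x y; rewrite !pE.
- by apply/eqP/lker0P => c d; rewrite !iE => -[].
- apply/vspaceP => u; apply/memv_imgP/idP => [[c _ ->]|].
    by rewrite memv_ker pE iE.
  rewrite memv_ker pE => /eqP u0; exists u.2; first exact: memvf.
  by rewrite iE -u0; case: (u).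
- apply/eqP; rewrite eqEsubv subvf; apply/subvP => x _.
  by apply/memv_imgP; exists (x, 0); rewrite ?memvf ?pE.
- move=> c x; rewrite iE; congr (_, _, _); apply: big1 => j _ /=.
  by rewrite !mxE !mul0r subr0.
Qed.

Theorem theorem1 (R : realType) (m : nat) (g : lieAlgType R)
    (cr : cr_structure g) :
  (1 <= m)%N ->
  \dim {:g} = m.*2.+1 ->
  lie_nilpotent g ->
  cr_nondegenerate cr ->
  [/\ pseudo_sasakian cr,
      exists n : lieAlgType R,
        [/\ pseudo_kahler n, lie_nilpotent n & central_extension g n]
    & strictly_pseudoconvex cr ->
        [/\ sasakian cr,
            lie_isomorphic g (heisenberg R m)
          & exists a : lieAlgType R,
              lie_abelian a /\ central_extension (heisenberg R m) a]].
Proof.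
move=> _ dimg nilg nondeg.
have psas : pseudo_sasakian cr.
  move=> phi ker_phi; have [eta phi_eta etaC] := nilpotent_reeb nilg nondeg ker_phi.
  exists eta; split; first split.
  - exact: is_reeb_central.
  - by move=> eta'; apply: (reeb_unique nondeg ker_phi).
  - by move=> X Y; exact: cr_metric_reeb.
split=> //.
  have [phi ker_phi] := hyperplane_form (cr_codim1 cr).
  have [eta phi_eta etaC] := nilpotent_reeb nilg nondeg ker_phi.
  exists (contact_quotient_lie ker_phi phi_eta etaC); split.
  - exact: quotient_pseudo_kahler dimg.
  - exact: lie_nilpotent_contact_quotient.
  - exact: contact_central_extension.
move=> /strictly_pseudoconvex_form [phi ker_phi form_pos].
have [eta phi_eta etaC] := nilpotent_reeb nilg nondeg ker_phi.
split; last exact: heisenberg_central_extension.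
  split=> //; exists phi, eta; split=> //; first exact: is_reeb_central.
  by move=> X; exact: cr_metric_pos.
apply: (two_step_heisenberg phi_eta etaC) => //.
  by move=> u; apply: (contact_nondegenerate ker_phi nondeg).
by move=> u v; apply: (positive_bracketE nilg ker_phi).
Qed.
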